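(* Let $a, a'\in\mathcal{A}$ be any two given apps with $a\neq a'$, and let $N^{\mathrm{cal}}\ge 1$. Let the calibration data $(x_n,y_n)$, $n=1,\dots,N^{\mathrm{cal}}$, be i.i.d. from $p(x|a')\,p(y_{a'}|x)$. Let the test pair $(x,y_{a'})$, formed by the test context and the counterfactual KPI vector, be independent of the calibration data and distributed as $p(x|a)\,p(y_{a'}|x)$. Suppose that the weights $w_{a'\to a}(x)=p(a|x)/p(a'|x)$ are known exactly and that the KPIs are observed without noise. Then, for any $\alpha\in[0,1]$ with $\alpha\ge 1/(N^{\mathrm{cal}}+1)$, the prediction set $\Gamma_{a'}(x|a)=\{\Gamma^k_{a'}(x|a)\}_{k=1}^K$ produced by the CCKE procedure (defined in the context) satisfies $$\Pr\big[y^k_{a'}\in\Gamma^k_{a'}(x|a)\ \text{for all } k=1,\dots,K\big]\ \ge\ 1-\alpha,$$ where the probability is with respect to the joint distribution of the calibration and test data.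
   Context: **Setting.** $\mathcal{A}$ is a finite set of apps, $\mathcal{X}$ is the space of contexts, and KPIs are vectors $y=[y^1,\dots,y^K]\in\mathbb{R}^K$. A context $x$, a selected app $a$, and potential outcomes $\{y_{a'}\}_{a'\in\mathcal{A}}$ (where $y_{a'}$ is the KPI vector that would be attained by app $a'$) are jointly distributed as $p(x,a,\{y_{a'}\}_{a'\in\mathcal{A}})=p(x)\,p(\{y_{a'}\}_{a'\in\mathcal{A}}|x)\,p(a|x)$. That is, given $x$, the app selection is independent of the potential outcomes. The observed KPI vector when app $a$ is selected is $y=y_a$. Write $p(x|a)=p(x)p(a|x)/p(a)$ with $p(a)>0$ for the distribution of the context given that app $a$ is selected, and $p(y_{a'}|x)$ for the conditional distribution of the potential outcome $y_{a'}$ given $x$. It is assumed that $p(a'|x)>0$, so that the weights $w_{a'\to a}(x)=p(a|x)/p(a'|x)$ are well defined. **CCKE procedure.** The level is $\alpha\in[0,1]$. Let $\hat q^k_{\alpha/2}(\cdot|\phi^* )$ and $\hat q^k_{1-\alpha/2}(\cdot|\phi^* )$, $k=1,\dots,K$, be real-valued (measurable) functions on $\mathcal{X}$. They are quantile estimates with a parameter $\phi^*$ trained on data independent of the calibration and test data, and may be arbitrary. 1. The score of each calibration point is $$s_n=\max_{k=1,\dots,K}\max\{\hat q^k_{\alpha/2}(x_n|\phi^* )-y_n^k,\ y_n^k-\hat q^k_{1-\alpha/2}(x_n|\phi^* )\}.$$ 2. For the test context $x$, define $$p_n(x)=\frac{w_{a'\to a}(x_n)}{\sum_{m=1}^{N^{\mathrm{cal}}}w_{a'\to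 a}(x_m)+w_{a'\to a}(x)},\qquad p_\infty(x)=\frac{w_{a'\to a}(x)}{\sum_{m=1}^{N^{\mathrm{cal}}}w_{a'\to a}(x_m)+w_{a'\to a}(x)}.$$ 3. The correction term is $$\hat q_w=\inf\Big\{s\in\mathbb{R}\cup\{+\infty\}:\ \sum_{n=1}^{N^{\mathrm{cal}}}p_n(x)\mathbf{1}(s_n\le s)+p_\infty(x)\mathbf{1}(\infty\le s)\ \ge\ \frac{(1-\alpha)(N^{\mathrm{cal}}+1)}{N^{\mathrm{cal}}}\Big\},$$ with the convention $\mathbf{1}(\infty\le\infty)=1$. 4. The prediction intervals are $$\Gamma^k_{a'}(x|a)=\big[\hat q^k_{\alpha/2}(x|\phi^* )-\hat q_w,\ \hat q^k_{1-\alpha/2}(x|\phi^* )+\hat q_w\big],\qquad k=1,\dots,K,$$ where the interval is $\mathbb{R}$ if $\hat q_w=+\infty$, and is empty if the lower end exceeds the upper end. *)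

(* Defs.v *)
From HB Require Import structures.
From mathcomp Require Import all_boot all_order all_algebra.
From mathcomp Require Import all_classical all_reals all_analysis.
From mathcomp Require Import measurable_realfun.
Set Implicit Arguments.
Unset Strict Implicit.
Unset Printing Implicit Defensive.
Import Order.TTheory GRing.Theory Num.Theory.
Import numFieldNormedType.Exports.
Local Open Scope classical_set_scope.
Local Open Scope ring_scope.

(* p(b | x), a Markov kernel from contexts to the finite set of apps. *)
Record app_selection d (X : measurableType d) (A : finType) (R : realType) := {
  sel :> X -> A -> R ;
  sel_meas : forall b, measurable_fun [set: X] (sel ^~ b) ;
  sel_ge0 : forall x b, 0 <= sel x b ;
  sel_sum1 : forall x, \sum_b sel x b = 1 }.

(* p(b) = E_{p(x)}[p(b | x)] *)
Definition app_prob d (X : measurableType d) (A : finType) (R : realType)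
    (pX : probability X R) (s : app_selection X A R) (b : A) : R :=
  fine (\int[pX]_x (s x b)%:E)%E.

(* p(x | b) = p(x) p(b | x) / p(b); it is the zero measure if p(b) = 0. *)
Definition ctx_given d (X : measurableType d) (A : finType) (R : realType)
    (pX : probability X R) (s : app_selection X A R) (b : A) (B : set X)
    : \bar R :=
  (\int[pX]_(x in B) (s x b / app_prob pX s b)%:E)%E.

Section ctx_given_measure.
Local Open Scope ereal_scope.
Context d (X : measurableType d) (A : finType) (R : realType)
  (pX : probability X R) (s : app_selection X A R) (b : A).

Let dens_ge0 x : 0 <= (s x b / app_prob pX s b)%:E.
Proof.
rewrite lee_fin divr_ge0 ?sel_ge0// fine_ge0// integral_ge0// => y _.
by rewrite lee_fin sel_ge0.
Qed.

Let dens_meas : measurable_fun [set: X]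
  (fun x => (s x b / app_prob pX s b)%:E).
Proof.
apply/measurable_EFinP; apply: measurable_funM; last exact: measurable_cst.
exact: sel_meas.
Qed.

Let ctx_given0 : ctx_given pX s b set0 = 0.
Proof. by rewrite /ctx_given integral_set0. Qed.

Let ctx_given_ge0 B : 0 <= ctx_given pX s b B.
Proof. exact: integral_ge0. Qed.

Let ctx_given_sigma_additive : semi_sigma_additive (ctx_given pX s b).
Proof.
move=> /= F mF tF mUF; rewrite /ctx_given ge0_integral_bigcup//=; last first.
  exact: measurable_funTS.
by apply: is_cvg_ereal_nneg_natsum_cond => n _ _; exact: integral_ge0.
Qed.

HB.instance Definition _ := isMeasure.Build _ _ _ (ctx_given pX s b)
  ctx_given0 ctx_given_ge0 ctx_given_sigma_additive.

End ctx_given_measure.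

(* The potential outcomes {y_b}_b of the apps are stored as a tuple indexed by
   the enumeration of A (functions on A carry no sigma-algebra in the library);
   the sigma-algebra is the product one. *)
Notation outcomes A K R := (#|A|.-tuple (K.-tuple R)).

Definition outcome (A : finType) (T : Type) (b : A) (y : #|A|.-tuple T) : T :=
  tnth y (enum_rank b).

(* p(y_b | x): marginal of p({y_c}_c | x) *)
Definition outcome_law d (X : measurableType d) (A : finType) (K : nat)
    (R : realType) (pY : R.-pker X ~> outcomes A K R) (b : A) (x : X)
    : set (K.-tuple R) -> \bar R :=
  pushforward (pY x) (@outcome A _ b).

(* p(x | c) p(y_b | x), a law on pairs (x, y_b) *)
Definition pair_law d (X : measurableType d) (A : finType) (K : nat)
    (R : realType) (pX : probability X R) (s : app_selection X A R)
    (pY : R.-pker X ~> outcomes A K R) (c b : A) (S : set (X * K.-tuple R))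
    : \bar R :=
  (\int[ctx_given pX s c]_x outcome_law pY b x (xsection S x))%E.

Definition mutually_independent d d' (Omega : measurableType d)
    (T : measurableType d') (R : realType) (P : probability Omega R) (N : nat)
    (Z : 'I_N -> Omega -> T) : Prop :=
  forall (J : {set 'I_N}) (B : 'I_N -> set T),
    (forall i, i \in J -> measurable (B i)) ->
    P (\bigcap_(i in [set` J]) Z i @^-1` B i) =
    (\prod_(i in J) P (Z i @^-1` B i))%E.

Definition independent d d1 d2 (Omega : measurableType d)
    (T1 : measurableType d1) (T2 : measurableType d2) (R : realType)
    (P : probability Omega R) (U : Omega -> T1) (V : Omega -> T2) : Prop :=
  forall B1 B2, measurable B1 -> measurable B2 ->
    P (U @^-1` B1 `&` V @^-1` B2) = (P (U @^-1` B1) * P (V @^-1` B2))%E.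

(* w_{a' -> a}(x) = p(a | x) / p(a' | x) *)
Definition weight d (X : measurableType d) (A : finType) (R : realType)
    (s : app_selection X A R) (a' a : A) (x : X) : R :=
  s x a / s x a'.

Section CCKE.
Context (X : Type) (K : nat) (R : realType).
Implicit Types (w : X -> R) (qlo qhi : 'I_K -> X -> R).

(* Extended-real valued, so that the maximum over an empty set of indices is
   -oo; it is a real number when 0 < K. *)
Definition score qlo qhi (z : X * K.-tuple R) : \bar R :=
  (\big[maxe/-oo]_(k < K)
     maxe (qlo k z.1 - tnth z.2 k)%:E (tnth z.2 k - qhi k z.1)%:E)%E.

Definition total_weight w N (D : N.-tuple (X * K.-tuple R)) (x : X) : R :=
  \sum_(m < N) w (tnth D m).1 + w x.

Definition cal_prob w N (D : N.-tuple (X * K.-tuple R)) (x : X) (n : 'I_N)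
    : R :=
  w (tnth D n).1 / total_weight w D x.

Definition inf_prob w N (D : N.-tuple (X * K.-tuple R)) (x : X) : R :=
  w x / total_weight w D x.

Definition weighted_cdf w qlo qhi N (D : N.-tuple (X * K.-tuple R)) (x : X)
    (t : \bar R) : R :=
  \sum_(n < N) cal_prob w D x n * (score qlo qhi (tnth D n) <= t)%E%:R
  + inf_prob w D x * (+oo <= t)%E%:R.

(* The infimum ranges over the reals and +oo; it is -oo only if the threshold
   is <= 0, i.e. alpha = 1. *)
Definition correction (alpha : R) w qlo qhi N (D : N.-tuple (X * K.-tuple R))
    (x : X) : \bar R :=
  ereal_inf [set t : \bar R | t <> -oo%E /\
    (1 - alpha) * N.+1%:R / N%:R <= weighted_cdf w qlo qhi D x t].

(* The whole line if the correction is +oo, empty if it is -oo. *)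
Definition ccke_interval (alpha : R) w qlo qhi N
    (D : N.-tuple (X * K.-tuple R)) (x : X) (k : 'I_K) : set R :=
  [set r | (qlo k x)%:E - correction alpha w qlo qhi D x <= r%:E /\
           r%:E <= (qhi k x)%:E + correction alpha w qlo qhi D x]%E.

End CCKE.

(* Main.v *)
Require Import Defs.
From HB Require Import structures.
From mathcomp Require Import all_boot all_order all_algebra.
From mathcomp Require Import perm.
From mathcomp Require Import all_classical all_reals all_analysis.
From mathcomp Require Import measurable_realfun ring lra.
Import Order.TTheory GRing.Theory Num.Theory.
Import numFieldNormedType.Exports.
Local Open Scope classical_set_scope.
Local Open Scope ring_scope.
Set Implicit Arguments.
Unset Strict Implicit.
Unset Printing Implicit Defensive.

(* Put Z_0 = (x, y_{a'}) for the test pair, Z_n for the calibration pairs,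
   w_n for the weight of Z_n, s_n for its score and W = w_0 + ... + w_N. The
   test pair is not covered only if the calibration points with s_n < s_0 carry
   at least a fraction 1 - alpha of W. The law of the test pair has density w / kappa,
   kappa = p(a) / p(a'), with respect to the law mu of a calibration pair, hence
   the probability of this event is E[w_0 1(event)] / kappa when Z_0, ..., Z_N
   are i.i.d. from mu. By exchangeability this is
     E[sum_i w_i 1(the points with s_n < s_i carry at least (1 - alpha) W)]
       / ((N + 1) kappa),
   and the sum is at most alpha W, where E[W] = (N + 1) kappa. *)

(** * Integration against a measure given by a density *)

Section density.
Context d (T : measurableType d) (R : realType).
Variables (mu nu : {measure set T -> \bar R}) (f : T -> R).
Hypothesis mf : measurable_fun [set: T] f.
Hypothesis f0 : forall x, 0 <= f x.
Hypothesis nuE : forall S, measurable S -> nu S = (\int[mu]_(x in S) (f x)%:E)%E.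
Local Open Scope ereal_scope.
Import HBNNSimple.

Lemma nnsfun_integral_density (h : {nnsfun T >-> R}) :
  \int[nu]_x (h x)%:E = \int[mu]_x ((h x)%:E * (f x)%:E).
Proof.
rewrite integralT_nnsfun sintegralE.
under [RHS]eq_integral => x _.
  rewrite fimfunE -fsumEFin// ge0_mule_fsuml; last first.
    by move=> y; exact: nnfun_muleindic_ge0.
  over.
rewrite ge0_integral_fsum//=; first last.
- by move=> y x _; rewrite mule_ge0 ?lee_fin//; exact: nnfun_muleindic_ge0.
- move=> y; apply: emeasurable_funM; last exact/measurable_EFinP.
  by apply/measurable_EFinP; exact: measurable_funM.
apply: eq_fsbigr => r; rewrite inE => -[x _ <-].
under eq_integral => y _ do rewrite EFinM -muleA.
rewrite ge0_integralZl//=; first last.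
- by rewrite lee_fin.
- by move=> y _; rewrite mule_ge0// lee_fin.
- by apply: emeasurable_funM; exact/measurable_EFinP.
rewrite nuE//; congr (_ * _).
rewrite integral_mkcond; apply: eq_integral => y _.
rewrite /patch indicE; case: (y \in _); first by rewrite mul1e.
by rewrite mul0e.
Qed.

(** Monotone convergence along one approximating sequence of simple functions, applied on both
    sides, carries the simple case over to [g]. *)
Lemma ge0_integral_density (g : T -> \bar R) :
  measurable_fun [set: T] g -> (forall x, 0 <= g x) ->
  \int[nu]_x g x = \int[mu]_x (g x * (f x)%:E).
Proof.
move=> mg g0; pose h := nnsfun_approx measurableT mg.
have hg x : (h n x)%:E @[n --> \oo] --> g x by exact: cvg_nnsfun_approx.
have ndh x : {homo (fun n => (h n x)%:E) : m n / (m <= n)%N >-> m <= n}.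
  by move=> m n mn; rewrite lee_fin; exact/lefP/nd_nnsfun_approx.
have -> : \int[nu]_x g x = limn (fun n => \int[nu]_x (h n x)%:E).
  rewrite -monotone_convergence//.
  - by apply: eq_integral => x _; apply/esym/cvg_lim => //; exact: hg.
  - by move=> n; exact/measurable_EFinP.
  - by move=> n x _; rewrite lee_fin.
under eq_fun do rewrite nnsfun_integral_density.
rewrite -monotone_convergence//.
- apply: eq_integral => x _; apply: cvg_lim => //.
  by apply: cvgeZr; [rewrite fin_numE|exact: hg].
- by move=> n; apply: emeasurable_funM; exact/measurable_EFinP.
- by move=> n x _; rewrite mule_ge0// lee_fin.
- by move=> x _ m n mn; rewrite lee_wpmul2r ?lee_fin//; exact: (ndh x).
Qed.

End density.

(** * Laws on tuples: boxes and permutations *)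

Lemma measurable_mktuple d d' (T : measurableType d) (Z : measurableType d')
    n (f : 'I_n -> T -> Z) :
  (forall i, measurable_fun [set: T] (f i)) ->
  measurable_fun [set: T] (fun x => [tuple f i x | i < n]).
Proof.
move=> mf; apply/measurable_fun_tnthP => i.
rewrite (_ : _ \o _ = f i)//.
by apply/funext => x /=; rewrite tnth_mktuple.
Qed.

Section tuple_product.
Context d (T : measurableType d) (R : realType) (n : nat).
Implicit Types B : 'I_n -> set T.

Definition tuple_box B : set (n.-tuple T) :=
  [set t | forall i, B i (tnth t i)].

Lemma measurable_tuple_box B : (forall i, measurable (B i)) ->
  measurable (tuple_box B).
Proof.
move=> mB.
have -> : tuple_box B = \big[setI/setT]_(i < n) ((@tnth _ T ^~ i) @^-1` B i).
  rewrite big_mkcond/= -bigcap_seq; apply/seteqP; split=> t /=.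
    by move=> Bt i _ /=; exact: Bt.
  by move=> Bt i; apply: (Bt i); rewrite /= mem_index_enum.
apply: bigsetI_measurable => i _; rewrite -[X in measurable X]setTI.
exact: measurable_tnth.
Qed.

(** Boxes are closed under intersection and generate the product sigma-algebra, so a probability is
    determined by its values on them. *)
Lemma tuple_measure_unique (m1 m2 : probability (n.-tuple T) R) :
  (forall B, (forall i, measurable (B i)) ->
    m1 (tuple_box B) = m2 (tuple_box B)) ->
  forall S, measurable S -> m1 S = m2 S.
Proof.
move=> m12 S mS.
pose G : set (set (n.-tuple T)) :=
  [set C | exists2 B, (forall i, measurable (B i)) & C = tuple_box B].
have GT : G setT by exists (fun=> setT) => //; apply/seteqP; split.
apply: (measure_unique G (fun=> setT)) => //.
- apply/seteqP; split; last first.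
    apply: smallest_sub; first exact: sigma_algebra_measurable.
    by move=> _ [B mB ->]; exact: measurable_tuple_box.
  apply: smallest_sub; first exact: smallest_sigma_algebra.
  move=> C; rewrite -bigcup_seq => -[i _ [B mB <-]].
  (* A generator constrains a single coordinate, so it is a box whose other sides are full. *)
  apply: sub_sigma_algebra; exists (fun j => if j == i then B else setT).
    by move=> j; case: ifP.
  rewrite setTI; apply/seteqP; split=> t /=.
    by move=> Bt j; case: eqP => // ->.
  by move=> /(_ i); rewrite eqxx.
- move=> _ _ [B mB ->] [C mC ->]; exists (fun i => B i `&` C i).
    by move=> i; exact: measurableI.
  apply/seteqP; split=> t /=; first by move=> [Bt Ct] i; split.
  by move=> BCt; split=> i; case: (BCt i).
- by apply/seteqP; split=> // x _; exists 0%N.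
- by move=> _ [B mB ->]; exact: m12.
- by move=> _ /=; rewrite probability_setT ltry.
Qed.

Definition tuple_perm (p : 'S_n) (t : n.-tuple T) : n.-tuple T :=
  [tuple tnth t (p i) | i < n].

Lemma measurable_tuple_perm p : measurable_fun [set: n.-tuple T] (tuple_perm p).
Proof.
by apply: measurable_mktuple => i; exact: measurable_tnth.
Qed.

(** Exchangeability of i.i.d. points: permuting the coordinates of a box only reorders the factors
    of its measure. *)
Lemma product_tuple_perm (mu : set T -> \bar R)
    (m : probability (n.-tuple T) R) (p : 'S_n) :
  (forall B, (forall i, measurable (B i)) ->
    m (tuple_box B) = \prod_(i < n) mu (B i))%E ->
  forall S, measurable S -> m (tuple_perm p @^-1` S) = m S.
Proof.
move=> mE S mS.
pose f : {mfun n.-tuple T >-> n.-tuple T} :=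
  HB.pack (tuple_perm p) (isMeasurableFun.Build _ _ _ _ _ (measurable_tuple_perm p)).
apply: (@tuple_measure_unique (distribution m f) m) => // B mB.
transitivity (m (tuple_box (fun i => B (p^-1%g i)))).
  congr (m _); apply/seteqP; split=> t /= Bt i.
    by have := Bt (p^-1%g i); rewrite tnth_mktuple permKV.
  by rewrite tnth_mktuple; have := Bt (p i); rewrite permK.
rewrite !mE//.
by rewrite (reindex_inj (@perm_inj _ p)); apply: eq_bigr => i _; rewrite permK.
Qed.

End tuple_product.

(** * Weighted ranks of exchangeable points *)

Lemma weighted_rank_sum (I : finType) (R : realFieldType)
    (disp : Order.disp_t) (S : orderType disp) (v : I -> R) (r : I -> S) (b : R) :
  (forall i, 0 <= v i) -> b <= 1 ->
  \sum_i v i * (b * \sum_j v j <= \sum_j v j * (r j < r i)%O%:R)%R%:R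
    <= (1 - b) * \sum_j v j.
Proof.
move=> v0 b1; set W := \sum_j v j.
have W0 : 0 <= W by exact: sumr_ge0.
pose B i := b * W <= \sum_j v j * (r j < r i)%O%:R.
have [i0 Bi0|B0] := pickP B; last first.
  rewrite big1 ?mulr_ge0 ?subr_ge0// => i _.
  by rewrite -/(B i) B0 mulr0.
(* The indices in B all have rank at least that of the lowest one, m, below
   which a fraction b of the total weight already lies. *)
pose m := [arg min_(i < i0 | B i) r i]%O.
have [Bm mmin] : B m /\ forall i, B i -> (r m <= r i)%O.
  by rewrite /m; case: arg_minP.
have -> : (1 - b) * W = W - b * W by rewrite mulrBl mul1r.
apply: (@le_trans _ _ (W - \sum_j v j * (r j < r m)%O%:R)); last first.
  by rewrite lerB.
(* The bound holds index by index. An index in [B] is not strictly below [m], so its full weight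
   survives on the right; ties do no harm because the comparison is strict. *)
rewrite /W -sumrB; apply: ler_sum => i _.
rewrite -/W -/(B i); have [Bi|_] := boolP (B i).
  by rewrite ltNge mmin// mulr0 subr0 mulr1.
by rewrite mulr0 -{1}(mulr1 (v i)) -mulrBr mulr_ge0// subr_ge0 lern1 leq_b1.
Qed.

Section conformal.
Context d (Z : measurableType d) (R : realType).
Variables (v : Z -> R) (sc : Z -> \bar R).
Hypotheses (mv : measurable_fun [set: Z] v) (v0 : forall z, 0 <= v z).
Hypothesis msc : measurable_fun [set: Z] sc.

(** The total weight multiplies [b] instead of dividing the mass below, so a vanishing total needs
    no convention here. *)
Definition heavy_below n (b : R) (t : n.-tuple Z) (i : 'I_n) : bool :=
  b * \sum_j v (tnth t j) <=
  \sum_j v (tnth t j) * (sc (tnth t j) < sc (tnth t i))%O%:R.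

Lemma measurable_heavy_below n b (i : 'I_n) :
  measurable_fun [set: n.-tuple Z] (fun t => heavy_below b t i).
Proof.
have mvt (j : 'I_n) : measurable_fun [set: n.-tuple Z] (fun t => v (tnth t j)).
  exact: (measurableT_comp mv (measurable_tnth j)).
have mst (j : 'I_n) : measurable_fun [set: n.-tuple Z] (fun t => sc (tnth t j)).
  exact: (measurableT_comp msc (measurable_tnth j)).
apply: measurable_fun_ler.
  by apply: measurable_funM => //; exact: measurable_sum.
apply: measurable_sum => j; apply: measurable_funM => //.
apply: (@measurableT_comp _ _ _ _ _ _ (fun c : bool => c%:R : R)) => //.
exact: measurable_fun_lte.
Qed.

Let term n b (t : n.-tuple Z) i := (v (tnth t i) * (heavy_below b t i)%:R)%:E.

Lemma measurable_term n b i : measurable_fun [set: n.-tuple Z] (term b ^~ i).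
Proof.
apply/measurable_EFinP; apply: measurable_funM.
  exact: (measurableT_comp mv (measurable_tnth i)).
apply: (@measurableT_comp _ _ _ _ _ _ (fun c : bool => c%:R : R)) => //.
exact: measurable_heavy_below.
Qed.

Lemma term_ge0 n b (t : n.-tuple Z) i : (0 <= term b t i)%E.
Proof. by rewrite lee_fin mulr_ge0. Qed.

Local Open Scope ereal_scope.

Lemma heavy_below_expectation n (mu : probability Z R)
    (m : probability (n.+1.-tuple Z) R) (b : R) :
  (b <= 1)%R ->
  (forall B, (forall i, measurable (B i)) ->
    m (tuple_box B) = \prod_(i < n.+1) mu (B i)) ->
  \int[m]_t (v (tnth t ord0) * (heavy_below b t ord0)%:R)%:E
    <= (1 - b)%:E * \int[mu]_z (v z)%:E.
Proof.
move=> b1 mE; rewrite -/(term b _ _).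
(* Transposing 0 and i preserves the law m and the condition in term. *)
have exch i : \int[m]_t term b t i = \int[m]_t term b t ord0.
  pose p := tperm ord0 i.
  pose f : {mfun n.+1.-tuple Z >-> n.+1.-tuple Z} := HB.pack (tuple_perm p)
    (isMeasurableFun.Build _ _ _ _ _ (measurable_tuple_perm p)).
  transitivity (\int[distribution m f]_t term b t ord0); last first.
    apply: eq_measure_integral => S mS _; exact: (product_tuple_perm _ mE).
  rewrite ge0_integral_distribution; last 2 first.
  - exact: measurable_term.
  - by move=> t; exact: term_ge0.
  apply: eq_integral => t _ /=; rewrite /term /heavy_below !tnth_mktuple tpermL.
  congr (_ * _%:R)%:E; congr (_ * _ <= _)%R.
    rewrite (reindex_inj (@perm_inj _ p))/=.
    by apply: eq_bigr => j _; rewrite tnth_mktuple.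
  rewrite (reindex_inj (@perm_inj _ p))/=.
  by apply: eq_bigr => j _; rewrite tnth_mktuple.
have marg (i : 'I_n.+1) : \int[m]_t (v (tnth t i))%:E = \int[mu]_z (v z)%:E.
  pose f : {mfun n.+1.-tuple Z >-> Z} := HB.pack (fun t : n.+1.-tuple Z => tnth t i)
    (isMeasurableFun.Build _ _ _ _ _ (measurable_tnth i)).
  transitivity (\int[distribution m f]_z (v z)%:E).
    by rewrite ge0_integral_distribution//; exact/measurable_EFinP.
  apply: eq_measure_integral => S mS _.
  (* Constraining coordinate [i] alone gives a box with full sides elsewhere, whose other factors
     are 1. *)
  transitivity (m (tuple_box (fun j => if j == i then S else setT))).
    congr (m _); apply/seteqP; split=> t /=.
      by move=> St j; case: eqP => // ->.
    by move=> /(_ i); rewrite eqxx.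
  rewrite mE; last by move=> j; case: ifP.
  rewrite (bigD1 i)//= eqxx big1 ?mule1// => j /negbTE ->.
  exact: probability_setT.
have n0 : (0 < n.+1%:R :> R)%R by rewrite ltr0n.
have Ef (x : \bar R) : n.+1%:R%:E * x = \sum_(i < n.+1) x.
  by rewrite mule_natl big_const_ord -Monoid.iteropE.
(* Multiplied by n + 1, both sides become sums over all positions, the left by exchangeability and
   the right by equality of the marginals. The integrands then compare pointwise by
   [weighted_rank_sum]. *)
rewrite -(@lee_pmul2l _ n.+1%:R%:E)//.
rewrite muleCA !Ef.
under [leLHS]eq_bigr => i _ do rewrite -(exch i).
under [X in _ <= _ * X]eq_bigr => i _ do rewrite -(marg i).
rewrite -!ge0_integral_sum//; last 4 first.
- by move=> i; apply/measurable_EFinP; exact: (measurableT_comp mv (measurable_tnth i)).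
- by move=> i t _; rewrite lee_fin.
- by move=> i; exact: measurable_term.
- by move=> i t _; exact: term_ge0.
rewrite -ge0_integralZl//; last 3 first.
- apply: emeasurable_sum => i; apply/measurable_EFinP.
  exact: (measurableT_comp mv (measurable_tnth i)).
- by move=> t _; apply: sume_ge0 => i _; rewrite lee_fin.
- by rewrite lee_fin subr_ge0.
apply: ge0_le_integral => //.
- by move=> t _; apply: sume_ge0 => i _; exact: term_ge0.
- by apply: emeasurable_sum => i; exact: measurable_term.
- apply: measurable_funeM; apply: emeasurable_sum => i; apply/measurable_EFinP.
  exact: (measurableT_comp mv (measurable_tnth i)).
move=> t _; rewrite !sumEFin -EFinM lee_fin.
exact: weighted_rank_sum.
Qed.

End conformal.

(** * Change of measure for the test point *)

Section covariate_shift.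
Context d (Z : measurableType d) (R : realType).
Variables (v : Z -> R) (sc : Z -> \bar R).
Hypotheses (mv : measurable_fun [set: Z] v) (v0 : forall z, 0 <= v z).
Hypothesis msc : measurable_fun [set: Z] sc.
Context dO (Omega : measurableType dO) (P : probability Omega R) (N : nat).
Variables (cal : 'I_N -> {RV P >-> Z}) (test : {RV P >-> Z}).
Variables (mu : probability Z R) (kappa : R).
Hypothesis kappa0 : 0 < kappa.
Hypothesis intv : (\int[mu]_z (v z)%:E = kappa%:E)%E.
Hypothesis cal_law : forall n S, measurable S -> distribution P (cal n) S = mu S.
Hypothesis cal_indep :
  mutually_independent P (fun n : 'I_N => cal n : Omega -> _).
Hypothesis test_law : forall S, measurable S ->
  (distribution P test S = \int[mu]_(z in S) (v z / kappa)%:E)%E.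
Hypothesis test_indep :
  independent P test (fun omega : Omega => [tuple cal n omega | n < N]).

Local Open Scope ereal_scope.

Let mcalT :
  measurable_fun [set: Omega] (fun omega => [tuple cal n omega | n < N]).
Proof.
by apply: measurable_mktuple => i; exact: measurable_funP.
Qed.

Let calT : {mfun Omega >-> N.-tuple Z} :=
  HB.pack (fun omega => [tuple cal n omega | n < N])
    (isMeasurableFun.Build _ _ _ _ _ mcalT).

Let joint : {mfun Omega >-> (Z * N.-tuple Z)%type} :=
  HB.pack (fun omega => (test omega, calT omega))
    (isMeasurableFun.Build _ _ _ _ _
      (measurable_fun_pair (measurable_funP test) (measurable_funP calT))).

Let mcons : measurable_fun [set: Z * N.-tuple Z]
  (fun z => [the N.+1.-tuple Z of z.1 :: z.2]).
Proof. exact: measurable_cons. Qed.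

Let cons_pair : {mfun (Z * N.-tuple Z)%type >-> N.+1.-tuple Z} :=
  HB.pack (fun z : Z * N.-tuple Z => [the N.+1.-tuple Z of z.1 :: z.2])
    (isMeasurableFun.Build _ _ _ _ _ mcons).

Let Q : probability (N.-tuple Z) R := distribution P calT.
Let nu : probability Z R := distribution P test.

(** Mutual independence, taken for the full index set, is the product formula on boxes. *)
Let cal_box B : (forall i, measurable (B i)) ->
  Q (tuple_box B) = \prod_(i < N) mu (B i).
Proof.
move=> mB; have := @cal_indep [set: 'I_N]%SET B (fun i _ => mB i).
rewrite (eq_bigl xpredT)/=; last by move=> i; rewrite inE.
under [in RHS]eq_bigr => i _ do rewrite -[P _]/(distribution P (cal i) (B i)) cal_law//.
move=> <-; congr (P _); apply/seteqP; split=> omega /=.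
  by move=> H i _ /=; have := H i; rewrite tnth_mktuple.
by move=> H i; rewrite tnth_mktuple; apply: (H i); rewrite /= inE.
Qed.

(** A fresh point from [mu] in front of the calibration tuple gives N + 1 i.i.d. points, the setting
    of [heavy_below_expectation]. *)
Let cons_box B : (forall i, measurable (B i)) ->
  distribution (mu \x Q) cons_pair (tuple_box B) = \prod_(i < N.+1) mu (B i).
Proof.
move=> mB; rewrite big_ord_recl -(@cal_box (fun i => B (lift ord0 i)))//.
rewrite -product_measure1E//; last exact: measurable_tuple_box.
congr (product_measure1 _ _ _); apply/seteqP; split=> -[z t] /=.
  by move=> H; split=> [|i]; [exact: (H ord0)|have := H (lift ord0 i); rewrite tnthS].
move=> [/= z0 H] i; have [->//|i0] := eqVneq i ord0.
have [j -> /=] : exists j, i = lift ord0 j.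
  by case: (unliftP ord0 i) i0 => [j ->|->]; [exists j|rewrite eqxx].
by rewrite tnthS; exact: H.
Qed.

Let joint_law S : measurable S -> P (joint @^-1` S) = (nu \x Q) S.
Proof.
move=> mS; apply/esym.
by apply: (product_measure_unique (m' := distribution P joint)).
Qed.

Lemma heavy_below_test (b : R) : (b <= 1)%R ->
  P [set omega | heavy_below v sc b
       [the N.+1.-tuple Z of test omega :: [tuple cal n omega | n < N]] ord0]
  <= (1 - b)%:E.
Proof.
move=> b1.
pose hb (z : Z * N.-tuple Z) := heavy_below v sc b (cons_pair z) ord0.
pose S := [set z | hb z].
have mhb : measurable_fun setT hb.
  exact: (measurableT_comp (measurable_heavy_below mv msc b ord0)).
have mS : measurable S by rewrite -[S]setTI; exact: (mhb measurableT [set true]).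
have mI : measurable_fun setT (fun z => (\1_S z : R)%:E).
  exact/measurable_EFinP/measurable_indic.
have mvk : measurable_fun setT (fun z => v z / kappa)%R.
  by apply: measurable_funM => //; exact: measurable_cst.
have vk0 z : (0 <= v z / kappa)%R by rewrite divr_ge0// ltW.
rewrite [X in P X](_ : _ = joint @^-1` S)// joint_law//.
(* Tonelli integrates the test point first, for a fixed calibration tuple, so that its law can be
   replaced by [mu] with density v / kappa. *)
rewrite -(setIT S) -integral_indic// fubini_tonelli2//.
rewrite /fubini_G.
under eq_integral => y _.
  rewrite (ge0_integral_density (mu := mu) mvk vk0)//; last first.
    exact: measurable_fun_pair1 mI.
  over.
pose g (z : Z * N.-tuple Z) := (\1_S z)%:E * (v z.1 / kappa)%:E.
have mg : measurable_fun setT g.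
  apply: emeasurable_funM => //; apply/measurable_EFinP.
  exact: (measurableT_comp mvk).
have g0 z : 0 <= g z by rewrite mule_ge0 ?lee_fin.
(* Tonelli backwards: the density is now part of the integrand and the test point is drawn from
   [mu]. *)
rewrite -[leLHS](@fubini_tonelli2 _ _ _ _ _ mu Q g)//.
have kE : (kappa^-1)%:E * kappa%:E = 1 by rewrite -EFinM mulVf// gt_eqF.
have -> : (1 - b)%:E = (kappa^-1)%:E * ((1 - b)%:E * kappa%:E).
  by rewrite muleCA kE mule1.
rewrite -intv.
apply: le_trans; last first.
  apply: lee_wpmul2l; first by rewrite lee_fin invr_ge0 ltW.
  exact: (heavy_below_expectation mv v0 msc b1 cons_box).
rewrite ge0_integral_distribution; last 2 first.
- exact: measurable_term.
- by move=> t; exact: term_ge0.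
rewrite -ge0_integralZl//=; last 3 first.
- apply: (@measurableT_comp _ _ _ _ _ _ (fun t : N.+1.-tuple Z =>
    (v (tnth t ord0) * (heavy_below v sc b t ord0)%:R)%:E)) => //.
  exact: measurable_term.
- by move=> z _; exact: term_ge0.
- by rewrite lee_fin invr_ge0 ltW.
rewrite le_eqVlt; apply/orP; left; apply/eqP; apply: eq_integral => z _.
rewrite /g -!EFinM; congr (_%:E).
have -> : (\1_S z : R) = (hb z)%:R.
  by rewrite indicE; congr (nat_of_bool _)%:R; apply/idP/idP; rewrite inE.
rewrite /hb /=.
by case: heavy_below; rewrite ?(mul0r, mulr0, mul1r, mulr1)// mulrC.
Qed.

End covariate_shift.

(** * The weights as a density between laws of pairs *)

Lemma measurable_fun_inv_ge0 d (T : measurableType d) (R : realType) (f : T -> R) :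
  measurable_fun [set: T] f -> (forall x, 0 <= f x) ->
  measurable_fun [set: T] (fun x => (f x)^-1).
Proof.
(* The power with exponent -1 agrees with the inverse on nonnegative reals, including at 0, where
   both are 0. *)
move=> mf f0; rewrite (_ : (fun _ => _) = fun x => f x `^ (-1)).
  exact: (measurableT_comp (@measurable_powR R (-1)) mf).
by apply/funext => x; rewrite powR_inv1.
Qed.

Section importance_weights.
Context d (X : measurableType d) (A : finType) (K : nat) (R : realType).
Variables (pX : probability X R) (s : app_selection X A R).
Variables (pY : R.-pker X ~> outcomes A K R).

Lemma measurable_weight a' a :
  measurable_fun [set: X] (weight s a' a).
Proof.
apply: measurable_funM; first exact: sel_meas.
by apply: measurable_fun_inv_ge0; [exact: sel_meas|move=> x; exact: sel_ge0].
Qed.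

Lemma weight_ge0 a' a x : 0 <= weight s a' a x.
Proof. by rewrite divr_ge0// sel_ge0. Qed.

Lemma measurable_outcome b :
  measurable_fun [set: outcomes A K R] (@outcome A _ b).
Proof. exact: measurable_tnth. Qed.

Lemma measurable_outcome_law b (S : set (X * K.-tuple R)) : measurable S ->
  measurable_fun [set: X] (fun x => outcome_law pY b x (xsection S x)).
Proof.
move=> mS.
(* Pulling [S] back along [f] turns the section under the outcome law into a section under the
   kernel [pY], to which measurability of kernel sections applies. *)
pose f (z : X * outcomes A K R) := (z.1, outcome b z.2).
have mf : measurable_fun setT f.
  apply: measurable_fun_pair => //.
  exact: (measurableT_comp (measurable_outcome b)).
rewrite (_ : (fun _ => _) = fun x => pY x (xsection (f @^-1` S) x)); last first.
  by apply/funext => x; rewrite /outcome_law /pushforward !xsectionE.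
apply: measurable_fun_xsection_finite_kernel.
by rewrite inE -[X in measurable X]setTI; exact: mf.
Qed.

Lemma outcome_law_le1 b x S : measurable S ->
  (0%E <= outcome_law pY b x S <= 1%E)%E.
Proof.
move=> mS; rewrite /outcome_law /pushforward measure_ge0/=.
rewrite -(@prob_kernel _ _ _ _ _ pY x); apply: le_measure => //; rewrite inE//.
by rewrite -[X in measurable X]setTI; exact: measurable_outcome.
Qed.

Lemma app_prob_ge0 b : 0 <= app_prob pX s b.
Proof.
by rewrite fine_ge0// integral_ge0// => x _; rewrite lee_fin sel_ge0.
Qed.

Let dens b x := s x b / app_prob pX s b.

Let mdens b : measurable_fun [set: X] (dens b).
Proof. by apply: measurable_funM; [exact: sel_meas|exact: measurable_cst]. Qed.

Let dens_ge0 b x : 0 <= dens b x.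
Proof. by rewrite divr_ge0 ?sel_ge0 ?app_prob_ge0. Qed.

Local Open Scope ereal_scope.

Lemma ge0_integral_ctx_given b (g : X -> \bar R) :
  measurable_fun [set: X] g -> (forall x, 0 <= g x) ->
  \int[ctx_given pX s b]_x g x =
  \int[pX]_x (g x * (s x b / app_prob pX s b)%:E).
Proof.
by move=> mg g0; rewrite (ge0_integral_density (mu := pX) (mdens b) (dens_ge0 b)).
Qed.

(** If p(b) were 0, the density of p(x | b) would be 0 by the convention for division by 0, and the
    pair law could not have mass 1. This yields p(a') > 0 from the law of a calibration pair. *)
Lemma app_prob_neq0 b c : pair_law pX s pY b c setT = 1 ->
  app_prob pX s b != 0%R.
Proof.
move=> pl1; apply/eqP => p0; move: pl1; rewrite /pair_law.
rewrite ge0_integral_ctx_given; last 2 first.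
- exact: measurable_outcome_law.
- by move=> x; case/andP: (@outcome_law_le1 c x _ (measurable_xsection x measurableT)).
under eq_integral do rewrite p0 invr0 mulr0 mule0.
by rewrite integral0 => /eqP; rewrite eqe eq_sym oner_eq0.
Qed.

Variables (a a' : A).
Hypothesis pa_gt0 : (0 < app_prob pX s a)%R.
Hypothesis sa'_gt0 : forall x, (0 < s x a')%R.
Variable mu : probability (X * K.-tuple R)%type R.
Hypothesis muE : forall S, measurable S -> mu S = pair_law pX s pY a' a' S.

(** By Bayes, p(x | a) has density w / kappa with respect to p(x | a'), and the conditional law of
    the outcome given x is the same in both pair laws. *)
Lemma pair_law_weight S : measurable S ->
  pair_law pX s pY a a' S =
  \int[mu]_(z in S)
    (weight s a' a z.1 / (app_prob pX s a / app_prob pX s a'))%:E.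
Proof.
move=> mS.
have pa'0 : app_prob pX s a' != 0%R.
  by apply: (@app_prob_neq0 _ a'); rewrite -muE// probability_setT.
set kappa := (app_prob pX s a / app_prob pX s a')%R.
have kappa0 : (0 <= kappa)%R by rewrite divr_ge0// app_prob_ge0.
pose h x := fine (outcome_law pY a' x (xsection S x)).
have hE x : outcome_law pY a' x (xsection S x) = (h x)%:E.
  have /andP[l0 l1] := @outcome_law_le1 a' x _ (measurable_xsection x mS).
  by rewrite fineK// ge0_fin_numE// (le_lt_trans l1)// ltry.
have h0 x : (0 <= h x)%R.
  by rewrite -lee_fin -hE; case/andP: (@outcome_law_le1 a' x _ (measurable_xsection x mS)).
have mh : measurable_fun setT h.
  apply/measurable_EFinP; rewrite (_ : _ \o _ = fun x =>
    outcome_law pY a' x (xsection S x)); first exact: measurable_outcome_law.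
  by apply/funext => x; rewrite hE.
pose w x := (weight s a' a x / kappa)%R.
have mw : measurable_fun setT w.
  by apply: measurable_funM; [exact: measurable_weight|exact: measurable_cst].
have w0 x : (0 <= w x)%R by rewrite divr_ge0// weight_ge0.
rewrite -/kappa -/(w _).
(* The first marginal of mu restricted to S has density h with respect to
   p(x | a'). *)
have ctxS B : measurable B ->
    pushforward (mrestr mu mS) fst B = \int[ctx_given pX s a']_(x in B) (h x)%:E.
  move=> mB; rewrite /pushforward /mrestr.
  have mFB : measurable (fst @^-1` B : set (X * K.-tuple R)).
    by rewrite -[X in measurable X]setTI; exact: measurable_fst.
  rewrite muE; last exact: measurableI.
  rewrite /pair_law [RHS]integral_mkcond; apply: eq_integral => x _.
  rewrite /patch; case: ifPn => xB.
    rewrite -hE; congr (outcome_law _ _ _ _); apply/seteqP; split=> y /=.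
      by rewrite /xsection/= !inE => -[].
    by rewrite /xsection/= !inE => ?; split=> //=; rewrite inE in xB.
  rewrite (_ : xsection _ _ = set0) /outcome_law ?/pushforward ?preimage_set0 ?measure0//.
  by apply/seteqP; split=> y //=; rewrite /xsection/= !inE => -[/= /mem_set]; rewrite (negbTE xB).
(* The weight depends on the context only, so the integral over [S] passes to the restriction of
   [mu] and then to its first marginal. *)
transitivity (\int[mrestr mu mS]_z (w z.1)%:E); last first.
  rewrite (@ge0_integral_density _ _ _ mu (mrestr mu mS) (\1_S)); last 5 first.
  - exact: measurable_indic.
  - by move=> z.
  - move=> B mB; rewrite integral_indic// setIC; exact: erefl.
  - by apply/measurable_EFinP; exact: (measurableT_comp mw).
  - by move=> z; rewrite lee_fin.
  rewrite [RHS]integral_mkcond; apply: eq_integral => z _.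
  by rewrite /patch indicE; case: (z \in S); rewrite ?mule1 ?mule0.
transitivity (\int[pushforward (mrestr mu mS) fst]_x (w x)%:E); last first.
  rewrite ge0_integral_pushforward//.
    by apply/measurable_EFinP; exact: mw.
  by move=> x _; rewrite lee_fin.
rewrite (ge0_integral_density (mu := ctx_given pX s a') mh h0 ctxS); last 3 first.
- exact: measurable_fst.
- by apply/measurable_EFinP; exact: mw.
- by move=> x; rewrite lee_fin.
rewrite ge0_integral_ctx_given; last 2 first.
- by apply: emeasurable_funM; exact/measurable_EFinP.
- by move=> x; rewrite mule_ge0// lee_fin.
rewrite /pair_law ge0_integral_ctx_given; last 2 first.
- exact: measurable_outcome_law.
- by move=> x; rewrite hE lee_fin.
apply: eq_integral => x _; rewrite hE -!EFinM; congr (_%:E).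
have pa0 : app_prob pX s a != 0%R by rewrite gt_eqF.
have sa'0 : s x a' != 0%R by rewrite gt_eqF.
rewrite /w /kappa /weight; field.
by rewrite pa0 pa'0 sa'0.
Qed.

End importance_weights.

(** * Coverage as a condition on weighted mass *)

Section ccke_event.
Context (X : Type) (K : nat) (R : realType).
Variables (alpha : R) (w : X -> R) (qlo qhi : 'I_K -> X -> R).
Hypotheses (K0 : (0 < K)%N) (w0 : forall x, 0 <= w x) (alpha1 : alpha < 1).
Local Notation score := (score qlo qhi).
Local Notation level N := ((1 - alpha) * N.+1%:R / N%:R).

Lemma score_leP (z : X * K.-tuple R) (c : \bar R) :
  (score z <= c)%E <-> forall k, ((qlo k z.1 - tnth z.2 k)%:E <= c)%E /\
                                 ((tnth z.2 k - qhi k z.1)%:E <= c)%E.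
Proof.
split=> [/bigmax_leP[_ H] k|H].
  by have := H k isT; rewrite ge_max => /andP.
apply/bigmax_leP; split=> [|k _]; first exact: leNye.
by rewrite ge_max; apply/andP.
Qed.

Lemma score_fin_num z : score z \is a fin_num.
Proof.
rewrite fin_numElt; apply/andP; split.
  rewrite ltNge; apply/negP => /score_leP/(_ (Ordinal K0))[].
  by rewrite leeNy_eq.
have [M HM] : exists M : R, forall k,
    qlo k z.1 - tnth z.2 k <= M /\ tnth z.2 k - qhi k z.1 <= M.
  exists (\sum_k (`|qlo k z.1 - tnth z.2 k| + `|tnth z.2 k - qhi k z.1|)) => k.
  rewrite (bigD1 k)//=; set r := \sum_(i < K | _) _.
  have r0 : 0 <= r by apply: sumr_ge0 => i _; rewrite addr_ge0.
  split; apply: (le_trans (ler_norm _)); last rewrite [`|qlo _ _ - _| + _]addrC.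
    by rewrite -addrA lerDl addr_ge0.
  by rewrite -addrA lerDl addr_ge0.
apply: (@le_lt_trans _ _ M%:E); last exact: ltry.
by apply/score_leP => k; rewrite !lee_fin.
Qed.

Lemma mem_ccke_interval N (D : N.-tuple (X * K.-tuple R)) x y :
  (forall k, ccke_interval alpha w qlo qhi D x k (tnth y k)) <->
  (score (x, y) <= correction alpha w qlo qhi D x)%E.
Proof.
rewrite score_leP /ccke_interval/=.
set c := correction _ _ _ _ _ _.
suff H k : ((qlo k x)%:E - c <= (tnth y k)%:E /\
            (tnth y k)%:E <= (qhi k x)%:E + c)%E <->
    ((qlo k x - tnth y k)%:E <= c /\ (tnth y k - qhi k x)%:E <= c)%E.
  by split=> + k => /(_ k) /H.
(* For a correction +oo both sides hold; for -oo both fail, the interval being empty and the scores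
   real. *)
case: c => [c| |].
- by rewrite -EFinN -!EFinD !lee_fin; split=> -[? ?]; split; lra.
- by rewrite /= addeNy addey// leNye !leey.
- by rewrite /= addey// addeNy !leeNy_eq leye_eq.
Qed.

Lemma cal_prob_ge0 N (D : N.-tuple (X * K.-tuple R)) x n :
  0 <= cal_prob w D x n.
Proof. by rewrite divr_ge0// addr_ge0// sumr_ge0. Qed.

Lemma level_gt0 N : (0 < N)%N -> 0 < level N.
Proof. by move=> N0; rewrite !mulr_gt0 ?invr_gt0 ?ltr0n ?subr_gt0. Qed.

(* The weighted cdf only jumps at the calibration scores, so the infimum is at
   least t0 exactly when the cdf is below the level just before t0; the level
   has to be positive because the infimum excludes -oo. *)
Lemma le_correction N (D : N.-tuple (X * K.-tuple R)) x (t0 : R) :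
  (0 < N)%N ->
  (t0%:E <= correction alpha w qlo qhi D x)%E =
  (\sum_(n < N) cal_prob w D x n * (score (tnth D n) < t0%:E)%E%:R < level N).
Proof.
move=> N0; apply/idP/idP; last first.
  move=> lt_level; apply: le_ereal_inf_tmp => t [_ tP].
  rewrite leNgt; apply/negP => tt0; move: tP; apply/negP; rewrite -ltNge.
  apply: le_lt_trans lt_level; rewrite /weighted_cdf.
  (* As [t] lies below the real [t0], the atom at +oo contributes nothing. *)
  rewrite leye_eq lt_eqF ?mulr0 ?addr0; last exact: lt_trans tt0 (ltry _).
  apply: ler_sum => n _; apply: ler_wpM2l; first exact: cal_prob_ge0.
  rewrite ler_nat; case: (boolP (score _ <= t)%E) => //= st.
  by rewrite (le_lt_trans st tt0).
move=> t0c; rewrite ltNge; apply/negP => level_le.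
have [n0 n0P] : exists n, (score (tnth D n) < t0%:E)%E.
  apply: contrapT => /forallNP H; move: level_le; apply/negP; rewrite -ltNge.
  rewrite big1 ?level_gt0// => n _.
  by rewrite (negbTE (introN idP (H n))) mulr0.
(* The largest calibration score below [t0] already reaches the level, so it bounds the infimum from
   above, strictly below [t0]. *)
pose m := [arg max_(n > n0 | (score (tnth D n) < t0%:E)%E) score (tnth D n)]%O.
have [mP mmax] : (score (tnth D m) < t0%:E)%E /\
    forall n, (score (tnth D n) < t0%:E)%E -> (score (tnth D n) <= score (tnth D m))%E.
  by rewrite /m; case: arg_maxP.
move: t0c; apply/negP; rewrite -ltNge; apply: le_lt_trans mP.
apply: ereal_inf_lbound; split.
  by move=> mNy; have := score_fin_num (tnth D m); rewrite mNy.
apply: (le_trans level_le); rewrite /weighted_cdf -[leLHS]addr0 lerD//.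
  apply: ler_sum => n _; apply: ler_wpM2l; first exact: cal_prob_ge0.
  by rewrite ler_nat; case: (boolP (score _ < t0%:E)%E) => //= /mmax ->.
by rewrite mulr_ge0// divr_ge0// addr_ge0// sumr_ge0.
Qed.

Definition cal_mass_below N (D : N.-tuple (X * K.-tuple R)) (z : X * K.-tuple R) : R :=
  \sum_(n < N) cal_prob w D z.1 n * (score (tnth D n) < score z)%E%:R.

Lemma ccke_eventE N (D : N.-tuple (X * K.-tuple R)) z : (0 < N)%N ->
  (forall k, ccke_interval alpha w qlo qhi D z.1 k (tnth z.2 k)) <->
  cal_mass_below D z < level N.
Proof.
move=> N0; rewrite mem_ccke_interval -surjective_pairing.
by rewrite -(fineK (score_fin_num z)) le_correction// fineK// score_fin_num.
Qed.

(** The test point is never strictly below itself, so the mass below it comes from calibration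
    points alone. The factor (N + 1) / N only raises the level above 1 - alpha. *)
Lemma not_ccke_heavy_below N (D : N.-tuple (X * K.-tuple R)) z : (0 < N)%N ->
  ~ cal_mass_below D z < level N ->
  (1 - alpha) * \sum_(j < N.+1) w (tnth [tuple of z :: D] j).1 <=
  \sum_(j < N.+1) w (tnth [tuple of z :: D] j).1 *
     (score (tnth [tuple of z :: D] j) < score z)%E%:R.
Proof.
move=> N0 /negP; rewrite -leNgt => level_le.
rewrite !big_ord_recl /= ltxx mulr0 add0r.
under eq_bigr do rewrite tnthS.
under [leRHS]eq_bigr do rewrite tnthS.
rewrite [w z.1 + _]addrC -/(total_weight w D z.1).
have W0 : 0 <= total_weight w D z.1 by rewrite addr_ge0// sumr_ge0.
have levelE : 1 - alpha <= level N.
  rewrite -mulrA; apply: ler_peMr; first by rewrite subr_ge0 ltW.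
  by rewrite ler_pdivlMr ?ltr0n// mul1r ler_nat.
have massE : cal_mass_below D z = (\sum_(n < N) w (tnth D n).1 *
    (score (tnth D n) < score z)%E%:R) / total_weight w D z.1.
  by rewrite mulr_suml; apply: eq_bigr => n _; rewrite mulrAC.
move: level_le; rewrite massE => level_le.
move: W0; rewrite le_eqVlt => /orP[/eqP W0|W0].
  (* With zero total weight all the normalized weights are 0, and the mass cannot reach the positive
     level. *)
  by move: level_le; rewrite -W0 invr0 mulr0 leNgt level_gt0.
by rewrite -ler_pdivlMr// (le_trans levelE).
Qed.

End ccke_event.

(** * Measurability of the coverage event and conclusion *)

Lemma measurable_score d (X : measurableType d) (K : nat) (R : realType)
    (qlo qhi : 'I_K -> X -> R) :
  (forall k, measurable_fun [set: X] (qlo k)) ->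
  (forall k, measurable_fun [set: X] (qhi k)) ->
  measurable_fun [set: X * K.-tuple R] (score qlo qhi).
Proof.
move=> mlo mhi; rewrite /score; elim: (index_enum _) => [|k r IH].
  by under eq_fun do rewrite big_nil; exact: measurable_cst.
under eq_fun do rewrite big_cons.
apply: measurable_maxe => //.
have my : measurable_fun [set: X * K.-tuple R] (fun z => tnth z.2 k).
  exact: (measurableT_comp (measurable_tnth k) measurable_snd).
apply: measurable_maxe; apply/measurable_EFinP; apply: measurable_funB => //.
  exact: (measurableT_comp (mlo k) measurable_fst).
exact: (measurableT_comp (mhi k) measurable_fst).
Qed.

Lemma measurable_cal_mass_below d (X : measurableType d) (K : nat) (R : realType)
    (w : X -> R) (qlo qhi : 'I_K -> X -> R) d' (T : measurableType d') (N : nat)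
    (cal : 'I_N -> T -> X * K.-tuple R) (test : T -> X * K.-tuple R) :
  measurable_fun [set: X] w -> (forall x, 0 <= w x) ->
  (forall k, measurable_fun [set: X] (qlo k)) ->
  (forall k, measurable_fun [set: X] (qhi k)) ->
  (forall n, measurable_fun [set: T] (cal n)) -> measurable_fun [set: T] test ->
  measurable_fun [set: T]
    (fun t => cal_mass_below w qlo qhi [tuple cal n t | n < N] (test t)).
Proof.
move=> mw w0 mlo mhi mcal mtest.
have mwz : measurable_fun [set: X * K.-tuple R] (fun z => w z.1).
  exact: (measurableT_comp mw measurable_fst).
have msc := measurable_score mlo mhi.
rewrite /cal_mass_below /cal_prob /total_weight.
under eq_fun do under eq_bigr do rewrite tnth_mktuple.
apply: measurable_sum => n; apply: measurable_funM.
  apply: measurable_funM; first exact: (measurableT_comp mwz (mcal n)).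
  apply: measurable_fun_inv_ge0; last by move=> t; rewrite addr_ge0// sumr_ge0.
  apply: measurable_funD; last exact: (measurableT_comp mwz mtest).
  apply: measurable_sum => m; under eq_fun do rewrite tnth_mktuple.
  exact: (measurableT_comp mwz (mcal m)).
apply: (@measurableT_comp _ _ _ _ _ _ (fun c : bool => c%:R : R)) => //.
apply: measurable_fun_lte; first exact: (measurableT_comp msc (mcal n)).
exact: (measurableT_comp msc mtest).
Qed.

Theorem lemma1 (R : realType)
  (* contexts, apps, number of KPIs *)
  (dX : measure_display) (X : measurableType dX) (A : finType)
  (K : nat) (hK : (0 < K)%N)
  (* p(x), p(a | x), p({y_a}_a | x) *)
  (pX : probability X R) (s : app_selection X A R)
  (pY : R.-pker X ~> outcomes A K R)
  (a a' : A) (haa' : a <> a')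
  (hpa : 0 < app_prob pX s a)
  (hpa' : forall x : X, 0 < s x a')
  (* quantile estimates at levels alpha/2 and 1 - alpha/2 *)
  (qlo qhi : 'I_K -> X -> R)
  (mqlo : forall k : 'I_K, measurable_fun [set: X] (qlo k))
  (mqhi : forall k : 'I_K, measurable_fun [set: X] (qhi k))
  (N : nat) (hN : (1 <= N)%N)
  (alpha : R) (halpha0 : 0 <= alpha) (halpha1 : alpha <= 1)
  (halphaN : 1 / N.+1%:R <= alpha)
  (* calibration data (x_n, y_n) and test pair (x, y_{a'}) *)
  (dO : measure_display) (Omega : measurableType dO)
  (P : probability Omega R)
  (cal : 'I_N -> {RV P >-> (X * K.-tuple R)%type})
  (test : {RV P >-> (X * K.-tuple R)%type})
  (cal_law : forall (n : 'I_N) (S : set (X * K.-tuple R)), measurable S ->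
    distribution P (cal n) S = pair_law pX s pY a' a' S)
  (cal_indep : mutually_independent P (fun n : 'I_N => cal n : Omega -> _))
  (test_law : forall S : set (X * K.-tuple R), measurable S ->
    distribution P test S = pair_law pX s pY a a' S)
  (test_indep : independent P test
    (fun omega : Omega => [tuple cal n omega | n < N])) :
  ((1 - alpha)%:E <=
   P [set omega : Omega | forall k : 'I_K,
       ccke_interval alpha (weight s a' a) qlo qhi
         [tuple cal n omega | n < N] (test omega).1 k
         (tnth (test omega).2 k)])%E.
Proof.
(* At alpha = 1 the level is 0 and the correction may be -oo, but the claimed bound is trivial. *)
have : alpha <= 1 by []; rewrite le_eqVlt => /orP[/eqP ->|alpha1].
  by rewrite subrr; exact: measure_ge0.
pose w := weight s a' a.
have mw : measurable_fun setT w by exact: measurable_weight.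
have w0 x : 0 <= w x by exact: weight_ge0.
pose calT omega := [tuple cal n omega | n < N].
pose E := [set omega | cal_mass_below w qlo qhi (calT omega) (test omega) <
                       (1 - alpha) * N.+1%:R / N%:R].
have -> : [set omega | forall k, ccke_interval alpha (weight s a' a) qlo qhi
    [tuple cal n omega | n < N] (test omega).1 k (tnth (test omega).2 k)] = E.
  by apply/seteqP; split=> omega /=; rewrite ccke_eventE.
have mE : measurable E.
  rewrite -[E]setTI; apply: (measurable_fun_ltr _ _ _ (Y := [set true])) => //.
  by apply: measurable_cal_mass_below => // n; exact: measurable_funP.
(* Since N >= 1, a first calibration pair exists; its law packages the pair law of a' as a
   probability. *)
pose mu : probability (X * K.-tuple R)%type R := distribution P (cal (Ordinal hN)).
have muE S : measurable S -> mu S = pair_law pX s pY a' a' S by exact: cal_law.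
pose kappa := app_prob pX s a / app_prob pX s a'.
have kappa0 : 0 < kappa.
  rewrite divr_gt0// lt_neqAle app_prob_ge0 andbT eq_sym.
  by apply: (@app_prob_neq0 _ _ _ _ _ _ _ pY _ a'); rewrite -muE// probability_setT.
have test_weight S : measurable S ->
    (distribution P test S = \int[mu]_(z in S) (w z.1 / kappa)%:E)%E.
  by move=> mS; rewrite test_law//; exact: pair_law_weight.
have mwz : measurable_fun [set: X * K.-tuple R] (fun z => w z.1).
  exact: (measurableT_comp mw measurable_fst).
(* The density w / kappa of the test law integrates to 1. *)
have intw : (\int[mu]_z (w z.1)%:E = kappa%:E)%E.
  transitivity (kappa%:E * \int[mu]_z (w z.1 / kappa)%:E)%E; last first.
    by rewrite -test_weight// probability_setT mule1.
  rewrite -ge0_integralZl//.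
  - by apply: eq_integral => z _; rewrite -EFinM mulrC divfK// gt_eqF.
  - by apply/measurable_EFinP; apply: measurable_funM.
  - by move=> z _; rewrite lee_fin divr_ge0// ltW.
  - by rewrite lee_fin ltW.
have msc := measurable_score mqlo mqhi.
have mcalT : measurable_fun setT calT.
  by apply: measurable_mktuple => i; exact: measurable_funP.
have /= heavy_le := heavy_below_test mwz (fun z => w0 z.1) msc kappa0 intw
  (fun n S mS => etrans (cal_law n S mS) (esym (muE S mS))) cal_indep
  test_weight test_indep (_ : 1 - alpha <= 1).
set H := (X in (P X <= _)%E) in heavy_le.
(* Noncoverage lies inside the heavy event for b = 1 - alpha, whose probability is at most 1 - b. *)
have PEc : (P (~` E) <= alpha%:E)%E.
  have -> : alpha%:E = (1 - (1 - alpha))%:E by congr (_%:E); ring.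
  apply: le_trans (heavy_le _); last by rewrite gerBl.
  apply: le_measure; rewrite ?inE.
  - exact: measurableC.
  - rewrite -[H]setTI; apply: (measurableT_comp
      (measurable_heavy_below mwz msc (1 - alpha) ord0)
      (measurable_cons (measurable_funP test) mcalT) measurableT (Y := [set true])) => //.
  - move=> omega; exact: not_ccke_heavy_below.
move: PEc; rewrite probability_setC// -(fineK (fin_num_measure P _ mE)).
by rewrite -EFinB !lee_fin => ?; lra.
Qed.
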